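(* The almost complex Cayley structure $J$ on $\mathbb{S}^{2,4}=\{x\in\mathbb{R}^{3,4}: g(x,x)=1\}$ is non-integrable, and the almost para-complex Cayley structure $P$ on $\mathbb{S}^{3,3}=\{x\in\mathbb{R}^{3,4}: g(x,x)=-1\}$ is non-integrable.
   Context: The split Cayley algebra $\mathbf{Ca}'$ is the real vector space of elements $a+be$ with $a,b$ quaternions, with multiplication $(a+be)(c+de)=(ac+\overline d\,b)+(da+b\overline c)e$. With $e_1,e_2,e_3$ the standard quaternion units ($e_1e_2=e_3$), put $e_4=e$, $e_5=e_1e$, $e_6=e_2e$, $e_7=e_3e$. Conjugation is $\overline x=x_0-x_1e_1-\dots-x_7e_7$, and $\langle\cdot,\cdot\rangle$ is the scalar product with quadratic form $x\overline x=x_0^2+x_1^2+x_2^2+x_3^2-x_4^2-x_5^2-x_6^2-x_7^2$. The space $\mathbb{R}^{3,4}=\Im(\mathbf{Ca}')=\mathrm{span}(e_1,\dots,e_7)$ carries the restriction $g$ of $\langle\cdot,\cdot\rangle$, of signature $(3,4)$. The vector cross product is $X\times Y=\Im(XY)=XY+g(X,Y)$. With normal vector $\mathbf n(x)=x$, the Cayley structures are $J_x(Y)=\mathbf n(x)\times Y$ for $Y\in T_x\mathbb{S}^{2,4}$ (so $J^2=-\mathrm{Id}$) and $P_x(Y)=\mathbf n(x)\times Y$ for $Y\in T_x\mathbb{S}^{3,3}$ (so $P^2=\mathrm{Id}$). An almost complex structure $J$ is integrable if and only if its Nijenhuis tensor $N(X,Y)=2([JX,JY]-[X,Y]-J[JX,Y]-J[X,JY])$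 vanishes identically. An almost para-complex structure $P$ is integrable if its eigen-distributions $T^{\pm}=\ker(\mathrm{Id}\mp P)$ are involutive; equivalently, $N_P(X,Y)=2([X,Y]+[PX,PY]-P[PX,Y]-P[X,PY])$ vanishes identically. *)

(* Defs.v *)
From HB Require Import structures.
From mathcomp Require Import all_boot all_order all_algebra ring.
From mathcomp Require Import all_classical all_reals all_analysis.

Set Implicit Arguments.
Unset Strict Implicit.
Unset Printing Implicit Defensive.

Import Order.TTheory GRing.Theory Num.Theory.
Import numFieldNormedType.Exports.
Local Open Scope classical_set_scope.
Local Open Scope ring_scope.

(* The quaternion q0 + q1 e1 + q2 e2 + q3 e3 is the row (q0, q1, q2, q3). *)
Definition quat (R : realType) := 'rV[R]_4.

Definition mkquat (R : realType) (a b c d : R) : quat R :=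
  \row_(i < 4) [:: a; b; c; d]`_i.

Definition qmul (R : realType) (p q : quat R) : quat R :=
  mkquat
    (p 0 0 * q 0 0 - p 0 1 * q 0 1 - p 0 2 * q 0 2 - p 0 3 * q 0 3)
    (p 0 0 * q 0 1 + p 0 1 * q 0 0 + p 0 2 * q 0 3 - p 0 3 * q 0 2)
    (p 0 0 * q 0 2 - p 0 1 * q 0 3 + p 0 2 * q 0 0 + p 0 3 * q 0 1)
    (p 0 0 * q 0 3 + p 0 1 * q 0 2 - p 0 2 * q 0 1 + p 0 3 * q 0 0).

Definition qconj (R : realType) (q : quat R) : quat R :=
  mkquat (q 0 0) (- q 0 1) (- q 0 2) (- q 0 3).

(* The split Cayley algebra: the pair (a, b) stands for a + b e. *)
Definition splitCayley (R : realType) := (quat R * quat R)%type.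

Definition camul (R : realType) (x y : splitCayley R) : splitCayley R :=
  let: (a, b) := x in
  let: (c, d) := y in
  (qmul a c + qmul (qconj d) b, qmul d a + qmul b (qconj c)).

Definition caone (R : realType) : splitCayley R := (mkquat 1 0 0 0, 0).

Definition caconj (R : realType) (x : splitCayley R) : splitCayley R :=
  (qconj x.1, - x.2).

Definition caform (R : realType) (x y : splitCayley R) : R :=
  \sum_(i < 4) x.1 0 i * y.1 0 i - \sum_(i < 4) x.2 0 i * y.2 0 i.

(* R^{3,4} = Im Ca': the entry of index i (from 0) is the coefficient of
   e_(i+1), where e_4 = e, e_5 = e_1 e, e_6 = e_2 e, e_7 = e_3 e. *)
Definition R34 (R : realType) := 'rV[R]_7.

Definition ofIm (R : realType) (x : R34 R) : splitCayley R :=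
  (mkquat 0 (x 0 0) (x 0 1) (x 0 2),
   mkquat (x 0 3) (x 0 4) (x 0 5) (x 0 6)).

Definition caIm (R : realType) (x : splitCayley R) : R34 R :=
  \row_(i < 7) [:: x.1 0 1; x.1 0 2; x.1 0 3;
                   x.2 0 0; x.2 0 1; x.2 0 2; x.2 0 3]`_i.

Definition g34 (R : realType) (X Y : R34 R) : R := caform (ofIm X) (ofIm Y).

Definition cross (R : realType) (X Y : R34 R) : R34 R :=
  caIm (camul (ofIm X) (ofIm Y)).

(* {x | g(x,x) = c}: S^{2,4} for c = 1 and S^{3,3} for c = -1. *)
Definition pseudosphere (R : realType) (c : R) : set (R34 R) :=
  [set x | g34 x x = c].

Definition S24 (R : realType) : set (R34 R) := pseudosphere (1 : R).
Definition S33 (R : realType) : set (R34 R) := pseudosphere (- 1 : R).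
Arguments S24 R : clear implicits.
Arguments S33 R : clear implicits.

(* For x on a pseudosphere, the tangent space is the g-orthogonal of the
   normal vector n(x) = x. *)
Definition normal_vector (R : realType) (x : R34 R) : R34 R := x.

Definition tangent (R : realType) (x : R34 R) : set (R34 R) :=
  [set Y | g34 (normal_vector x) Y = 0].

(* Y |-> n(x) x Y is J_x on T_x S^{2,4} and P_x on T_x S^{3,3}; as a function
   of x it is defined on all of R^{3,4}. *)
Definition cayley_structure (R : realType) (x Y : R34 R) : R34 R :=
  cross (normal_vector x) Y.

Lemma quat_sumE (R : realType) (f : 'I_4 -> R) :
  \sum_(i < 4) f i = f 0 + f 1 + f 2 + f 3.
Proof.
rewrite !big_ord_recl big_ord0 addr0 !addrA.
by congr (_ + f _ + f _ + f _); apply: val_inj.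
Qed.

Lemma quatP (R : realType) (p q : quat R) :
  p 0 0 = q 0 0 -> p 0 1 = q 0 1 -> p 0 2 = q 0 2 -> p 0 3 = q 0 3 -> p = q.
Proof.
move=> h0 h1 h2 h3; apply/rowP => -[[|[|[|[|//]]]] Hi].
- by rewrite (_ : Ordinal _ = 0) //; apply: val_inj.
- by rewrite (_ : Ordinal _ = 1) //; apply: val_inj.
- by rewrite (_ : Ordinal _ = 2) //; apply: val_inj.
- by rewrite (_ : Ordinal _ = 3) //; apply: val_inj.
Qed.

Lemma R34P (R : realType) (x y : R34 R) :
  x 0 0 = y 0 0 -> x 0 1 = y 0 1 -> x 0 2 = y 0 2 -> x 0 3 = y 0 3 ->
  x 0 4 = y 0 4 -> x 0 5 = y 0 5 -> x 0 6 = y 0 6 -> x = y.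
Proof.
move=> h0 h1 h2 h3 h4 h5 h6.
apply/rowP => -[[|[|[|[|[|[|[|//]]]]]]] Hi].
- by rewrite (_ : Ordinal _ = 0) //; apply: val_inj.
- by rewrite (_ : Ordinal _ = 1) //; apply: val_inj.
- by rewrite (_ : Ordinal _ = 2) //; apply: val_inj.
- by rewrite (_ : Ordinal _ = 3) //; apply: val_inj.
- by rewrite (_ : Ordinal _ = 4) //; apply: val_inj.
- by rewrite (_ : Ordinal _ = 5) //; apply: val_inj.
- by rewrite (_ : Ordinal _ = 6) //; apply: val_inj.
Qed.

Lemma mkquatE (R : realType) (a b c d : R) :
  (mkquat a b c d 0 0 = a) * (mkquat a b c d 0 1 = b) *
  (mkquat a b c d 0 2 = c) * (mkquat a b c d 0 3 = d).
Proof. by rewrite !mxE. Qed.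

Lemma caImE (R : realType) (x : splitCayley R) :
  (caIm x 0 0 = x.1 0 1) * (caIm x 0 1 = x.1 0 2) * (caIm x 0 2 = x.1 0 3) *
  (caIm x 0 3 = x.2 0 0) * (caIm x 0 4 = x.2 0 1) * (caIm x 0 5 = x.2 0 2) *
  (caIm x 0 6 = x.2 0 3).
Proof. by rewrite !mxE. Qed.

Lemma rowE (R : realType) n (i : 'I_n) :
  (forall p q : 'rV[R]_n, (p + q) 0 i = p 0 i + q 0 i) *
  (forall p : 'rV[R]_n, (- p) 0 i = - p 0 i) *
  (forall k (p : 'rV[R]_n), (k *: p) 0 i = k * p 0 i) *
  ((0 : 'rV[R]_n) 0 i = 0).
Proof. by do !split => *; rewrite !mxE. Qed.

Lemma splitCayleyE (R : realType) :
  (forall x y : splitCayley R, (x + y).1 = x.1 + y.1) *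
  (forall x y : splitCayley R, (x + y).2 = x.2 + y.2) *
  (forall k (x : splitCayley R), (k *: x).1 = k *: x.1) *
  (forall k (x : splitCayley R), (k *: x).2 = k *: x.2).
Proof. by []. Qed.

Lemma splitCayleyP (R : realType) (x y : splitCayley R) :
  x.1 = y.1 -> x.2 = y.2 -> x = y.
Proof. by case: x y => [a b] [c d] /= -> ->. Qed.

Lemma camulE (R : realType) (x y : splitCayley R) :
  ((camul x y).1 = qmul x.1 y.1 + qmul (qconj y.2) x.2) *
  ((camul x y).2 = qmul y.2 x.1 + qmul x.2 (qconj y.1)).
Proof. by case: x y => [a b] [c d]. Qed.

(* Generalizing the entries keeps ring from comparing them by conversion. *)
Ltac gen_quat q := move: (q 0 0) (q 0 1) (q 0 2) (q 0 3).
Ltac gen_R34 x :=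
  move: (x 0 0) (x 0 1) (x 0 2) (x 0 3) (x 0 4) (x 0 5) (x 0 6).

Lemma caform_conj (R : realType) (x : splitCayley R) :
  camul x (caconj x) = caform x x *: caone R.
Proof.
rewrite /caform !quat_sumE.
apply: splitCayleyP; rewrite camulE splitCayleyE /caone /caconj /fst /snd.
  by apply: quatP; rewrite /qmul /qconj !(mkquatE, rowE);
    gen_quat x.1; gen_quat x.2 => *; ring.
by apply: quatP; rewrite /qmul /qconj !(mkquatE, rowE);
  gen_quat x.1; gen_quat x.2 => *; ring.
Qed.

Lemma g34E (R : realType) (X Y : R34 R) :
  g34 X Y = X 0 0 * Y 0 0 + X 0 1 * Y 0 1 + X 0 2 * Y 0 2
   - X 0 3 * Y 0 3 - X 0 4 * Y 0 4 - X 0 5 * Y 0 5 - X 0 6 * Y 0 6.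
Proof.
by rewrite /g34 /caform !quat_sumE /ofIm /fst /snd !mkquatE; gen_R34 X; gen_R34 Y => *; ring.
Qed.

Lemma crossE (R : realType) (X Y : R34 R) :
  (cross X Y 0 0 =
      X 0 1 * Y 0 2 + X 0 4 * Y 0 3 + X 0 5 * Y 0 6
       - X 0 2 * Y 0 1 - X 0 3 * Y 0 4 - X 0 6 * Y 0 5) *
  (cross X Y 0 1 =
      X 0 2 * Y 0 0 + X 0 5 * Y 0 3 + X 0 6 * Y 0 4
       - X 0 0 * Y 0 2 - X 0 3 * Y 0 5 - X 0 4 * Y 0 6) *
  (cross X Y 0 2 =
      X 0 0 * Y 0 1 + X 0 4 * Y 0 5 + X 0 6 * Y 0 3
       - X 0 1 * Y 0 0 - X 0 3 * Y 0 6 - X 0 5 * Y 0 4) *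
  (cross X Y 0 3 =
      X 0 4 * Y 0 0 + X 0 5 * Y 0 1 + X 0 6 * Y 0 2
       - X 0 0 * Y 0 4 - X 0 1 * Y 0 5 - X 0 2 * Y 0 6) *
  (cross X Y 0 4 =
      X 0 0 * Y 0 3 + X 0 2 * Y 0 5 + X 0 6 * Y 0 1
       - X 0 1 * Y 0 6 - X 0 3 * Y 0 0 - X 0 5 * Y 0 2) *
  (cross X Y 0 5 =
      X 0 0 * Y 0 6 + X 0 1 * Y 0 3 + X 0 4 * Y 0 2
       - X 0 2 * Y 0 4 - X 0 3 * Y 0 1 - X 0 6 * Y 0 0) *
  (cross X Y 0 6 =
      X 0 1 * Y 0 4 + X 0 2 * Y 0 3 + X 0 5 * Y 0 0
       - X 0 0 * Y 0 5 - X 0 3 * Y 0 2 - X 0 4 * Y 0 1).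
Proof.
rewrite !caImE !camulE /ofIm /fst /snd /qmul /qconj !(mkquatE, rowE).
by gen_R34 X; gen_R34 Y => *; do !split; ring.
Qed.

Lemma cross_camul (R : realType) (X Y : R34 R) :
  ofIm (cross X Y) = camul (ofIm X) (ofIm Y) + g34 X Y *: caone R.
Proof.
rewrite g34E; apply: splitCayleyP.
  rewrite !splitCayleyE camulE /caone /ofIm /fst /snd.
  by apply: quatP; rewrite /qmul /qconj !(mkquatE, rowE) ?crossE;
    gen_R34 X; gen_R34 Y => *; ring.
rewrite !splitCayleyE camulE /caone /ofIm /fst /snd.
by apply: quatP; rewrite /qmul /qconj !(mkquatE, rowE) ?crossE;
  gen_R34 X; gen_R34 Y => *; ring.
Qed.

Lemma cayley_tangent (R : realType) (x Y : R34 R) :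
  tangent x (cayley_structure x Y).
Proof.
rewrite /tangent /= g34E /cayley_structure /normal_vector !crossE.
by gen_R34 x; gen_R34 Y => *; ring.
Qed.

Lemma cayley_sq (R : realType) (x Y : R34 R) :
  tangent x Y -> cayley_structure x (cayley_structure x Y) = - g34 x x *: Y.
Proof.
have -> : cayley_structure x (cayley_structure x Y) =
          g34 x Y *: x - g34 x x *: Y.
  rewrite /cayley_structure /normal_vector !g34E.
  by apply: R34P; rewrite !(rowE, crossE); gen_R34 x; gen_R34 Y => *; ring.
by rewrite /tangent /= /normal_vector => ->; rewrite scale0r sub0r scaleNr.
Qed.

Lemma cayley_almost_complex (R : realType) (x Y : R34 R) :
  S24 R x -> tangent x Y ->
  cayley_structure x (cayley_structure x Y) = - Y.
Proof. by move=> xS /cayley_sq ->; rewrite xS scaleN1r. Qed.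

Lemma cayley_almost_paracomplex (R : realType) (x Y : R34 R) :
  S33 R x -> tangent x Y ->
  cayley_structure x (cayley_structure x Y) = Y.
Proof. by move=> xS /cayley_sq ->; rewrite xS opprK scale1r. Qed.

Fixpoint Ck (R : realType) (V W : normedModType R) (k : nat) (U : set V)
    (f : V -> W) : Prop :=
  if k is k'.+1 then
    (forall x, U x -> differentiable f x) /\ (forall v, Ck k' U ('D_v f))
  else forall x, U x -> {for x, continuous f}.

Definition smooth_on (R : realType) (V W : normedModType R) (U : set V)
    (f : V -> W) : Prop := forall k, Ck k U f.

(* A smooth vector field on the relatively open subset S `&` U of S, given by
   a smooth map on the open set U of the ambient space that is tangent to S
   along S; every smooth local vector field of S is locally of this form. *)
Definition local_field (R : realType) (S U : set (R34 R))
    (X : R34 R -> R34 R) : Prop :=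
  smooth_on U X /\ forall x, S x -> U x -> tangent x (X x).

(* Flat-coordinate Lie bracket.  At a point of S and for two fields tangent
   to S along S, its value depends only on the restrictions of the fields to
   S, and is their Lie bracket as vector fields on S. *)
Definition lie_bracket (R : realType) (X Y : R34 R -> R34 R) (x : R34 R) :
    R34 R := 'D_(X x) Y x - 'D_(Y x) X x.

(* Below, a field of endomorphisms of the tangent spaces of S is given by a
   function J defined on the whole ambient space, so that x |-> J x (X x) is
   again defined on U. *)
Definition apply_field (R : realType) (A : R34 R -> R34 R -> R34 R)
    (X : R34 R -> R34 R) (x : R34 R) : R34 R := A x (X x).

Definition nijenhuis (R : realType) (J : R34 R -> R34 R -> R34 R)
    (X Y : R34 R -> R34 R) (x : R34 R) : R34 R :=
  let JX := apply_field J X in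
  let JY := apply_field J Y in
  (lie_bracket JX JY x - lie_bracket X Y x
   - J x (lie_bracket JX Y x) - J x (lie_bracket X JY x)) *+ 2.

Definition integrable_almost_complex (R : realType) (S : set (R34 R))
    (J : R34 R -> R34 R -> R34 R) : Prop :=
  forall (U : set (R34 R)) (X Y : R34 R -> R34 R),
    open U -> local_field S U X -> local_field S U Y ->
    forall x, S x -> U x -> nijenhuis J X Y x = 0.

(* T^+ = ker (Id - P) and T^- = ker (Id + P) *)
Definition eigen_plus (R : realType) (P : R34 R -> R34 R -> R34 R)
    (x : R34 R) : set (R34 R) := [set Y | tangent x Y /\ Y - P x Y = 0].

Definition eigen_minus (R : realType) (P : R34 R -> R34 R -> R34 R)
    (x : R34 R) : set (R34 R) := [set Y | tangent x Y /\ Y + P x Y = 0].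

Definition section_of (R : realType) (S U : set (R34 R))
    (D : R34 R -> set (R34 R)) (X : R34 R -> R34 R) : Prop :=
  local_field S U X /\ forall x, S x -> U x -> D x (X x).

Definition involutive_distribution (R : realType) (S : set (R34 R))
    (D : R34 R -> set (R34 R)) : Prop :=
  forall (U : set (R34 R)) (X Y : R34 R -> R34 R),
    open U -> section_of S U D X -> section_of S U D Y ->
    forall x, S x -> U x -> D x (lie_bracket X Y x).

Definition integrable_almost_paracomplex (R : realType) (S : set (R34 R))
    (P : R34 R -> R34 R -> R34 R) : Prop :=
  involutive_distribution S (eigen_plus P) /\
  involutive_distribution S (eigen_minus P).

(* Main.v *)
Require Import Defs.
From HB Require Import structures.
From mathcomp Require Import all_boot all_order all_algebra ring.
From mathcomp Require Import all_classical all_reals all_analysis.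

Set Implicit Arguments.
Unset Strict Implicit.
Unset Printing Implicit Defensive.

Import Order.TTheory GRing.Theory Num.Theory.
Import numFieldNormedType.Exports.
Local Open Scope classical_set_scope.
Local Open Scope ring_scope.

(** The field of endomorphisms J_x = x × _ is linear in x, so its derivative
in the direction v is v × _ (the cross product is also written × in these
comments).  Its failure to be integrable is therefore measured by the cross
product itself, which does not vanish on tangent vectors.

On S^{2,4}, the product rule D_v (x × Y) = v × Y + x × D_v Y
([derive_cross]) cancels all derivatives of X and Y in the Nijenhuis tensor
except those in the term [X, Y] + J J [X, Y], which vanishes because [X, Y] is
tangent and J J = - Id.  What remains is
N(X, Y) = 2 (JX × Y + X × JY - 2 J(X × Y)) ([nijenhuis_cayley]); when x, X,
JX, Y, JY are orthogonal this is - 8 J(X × Y).  At x = e_1 the linear fields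
x × e_2 and x × e_4 take the values e_3 and e_5, and N = - 8 e_7
([nijenhuis_killing]).

On S^{3,3}, for sections X and Y of T^+, differentiating x × X = X along Y
and x × Y = Y along X gives [X, Y] - P [X, Y] = 2 (X × Y), so that T^+ is
involutive only if the cross product vanishes on it.  Since P P = Id, every a
gives a section (Id + P)(x × a) of T^+ ([eigen_plus_section]).  At x = e_4 the
vectors a = e_1 and a = e_2 give X = e_1 - e_5 and Y = e_2 - e_6, with
X × Y = 2 (e_3 + e_7), and the bracket 2 (e_3 + e_7) lies in T^-
([lie_bracket_eigen_plus]).

All these fields are built from the identity and constants by sums and cross
products, operations that preserve smoothness ([CkD], [Ck_bilin]). *)

(** * The product rule for continuous bilinear maps *)

Section Bilinear.
Variables (R : realType) (V U1 U2 W : normedModType R).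
Variable B : {bilinear U1 -> U2 -> W}.
Hypothesis B_cont : continuous (fun p => B p.1 p.2).
Implicit Types (f : V -> U1) (g : V -> U2).

Lemma is_diff_bilin f g x : differentiable f x -> differentiable g x ->
  is_diff x (fun y => B (f y) (g y))
            (fun v => B (f x) ('d g x v) + B ('d f x v) (g x)).
Proof.
move=> df dg; have dB := differentiable_bilin (f x, g x) B_cont.
have dfg := differentiable_pair df dg.
apply: DiffDef; first exact: (differentiable_comp dfg dB).
by rewrite (diff_comp dfg dB) diff_bilin // diff_pair.
Qed.

Lemma derive_bilin f g x v : differentiable f x -> differentiable g x ->
  'D_v (fun y => B (f y) (g y)) x =
  B ('D_v f x) (g x) + B (f x) ('D_v g x).
Proof.
move=> df dg; have dB := is_diff_bilin df dg.
by rewrite !deriveE // diff_val addrC.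
Qed.

Lemma continuous_bilin f g x :
  {for x, continuous f} -> {for x, continuous g} ->
  {for x, continuous (fun y => B (f y) (g y))}.
Proof.
move=> cf cg.
have cfg : {for x, continuous (fun y => (f y, g y))} by exact: cvg_pair.
apply: (@continuous_comp _ _ _ (fun y => (f y, g y)) (fun p => B p.1 p.2)).
  exact: cfg.
exact: B_cont.
Qed.

End Bilinear.

(** * Closure properties of smooth maps *)

Section Smooth.
Variables (R : realType) (V : normedModType R).

Lemma CkS (W : normedModType R) k (U : set V) (f : V -> W) :
  Ck k.+1 U f -> Ck k U f.
Proof.
elim: k f => [|k IHk] f [df Df]; last by split=> // v; apply: IHk; exact: Df.
by move=> x Ux; exact/differentiable_continuous/df.
Qed.

Lemma Ck_cst (W : normedModType R) k (U : set V) (c : W) : Ck k U (cst c).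
Proof.
elim: k c => [|k IHk] c; first by move=> x _; exact: cst_continuous.
split=> [x _|v]; first exact: differentiable_cst.
rewrite (_ : 'D_v (cst c) = cst 0); first exact: IHk.
by apply/funext => x; rewrite derive_cst.
Qed.

Lemma Ck_id k (U : set V) : Ck k U (@idfun V).
Proof.
case: k => [|k]; first by move=> x _; exact: cvg_id.
split=> [x _|v]; first exact: ex_diff.
rewrite (_ : 'D_v idfun = cst v); first exact: Ck_cst.
by apply/funext => x; rewrite derive_id.
Qed.

(** The domain is the whole space so that the formula for 'D_v (f + g) is an
equality of functions, to which the induction hypothesis applies. *)
Lemma CkD (W : normedModType R) k (f g : V -> W) :
  Ck k setT f -> Ck k setT g -> Ck k setT (fun x => f x + g x).
Proof.
elim: k f g => [|k IHk] f g.
  by move=> cf cg x Ux; apply: cvgD; [exact: cf|exact: cg].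
move=> [df Df] [dg Dg]; split=> [x Ux|v].
  by apply: differentiableD; [exact: df|exact: dg].
have -> : 'D_v (fun x => f x + g x) = fun x => 'D_v f x + 'D_v g x.
  by apply/funext => x; apply: deriveD;
    [exact/diff_derivable/df|exact/diff_derivable/dg].
exact: IHk (Df v) (Dg v).
Qed.

(** By induction on k: the product rule expresses 'D_v of the product by
products of a derivative (of class k) with one of the maps (of class k.+1). *)
Lemma Ck_bilin (U1 U2 W : normedModType R) (B : {bilinear U1 -> U2 -> W})
    k (f : V -> U1) (g : V -> U2) :
  continuous (fun p => B p.1 p.2) ->
  Ck k setT f -> Ck k setT g -> Ck k setT (fun x => B (f x) (g x)).
Proof.
move=> cB; elim: k f g => [|k IHk] f g.
  by move=> cf cg x Ux; apply: continuous_bilin => //; [exact: cf|exact: cg].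
move=> Cf Cg; have [[df Df] [dg Dg]] := (Cf, Cg); split=> [x Ux|v].
  by have := is_diff_bilin cB (df x Ux) (dg x Ux).
have -> : 'D_v (fun x => B (f x) (g x)) =
          fun x => B ('D_v f x) (g x) + B (f x) ('D_v g x).
  by apply/funext => x; apply: derive_bilin; [|exact: df|exact: dg].
by apply: CkD; [exact: IHk (Df v) (CkS Cg)|exact: IHk (CkS Cf) (Dg v)].
Qed.

End Smooth.

(** In coordinates the map is a finite sum of products of two coordinate
functions with constant vectors. *)
Lemma bilinear_rV_continuous (R : realType) (W : normedModType R) m n
    (B : {bilinear 'rV[R]_m -> 'rV[R]_n -> W}) :
  continuous (fun p => B p.1 p.2).
Proof.
have BE : (fun p => B p.1 p.2) = fun p : 'rV[R]_m * 'rV[R]_n =>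
    \sum_i \sum_j p.1 0 i *: (p.2 0 j *: B (delta_mx 0 i) (delta_mx 0 j)).
  apply/funext => -[x y] /=; rewrite {1}[x]row_sum_delta linear_sumlz.
  apply: eq_bigr => i _; rewrite linearZl_LR {1}[y]row_sum_delta linear_sumr.
  by rewrite scaler_sumr; apply: eq_bigr => j _; rewrite linearZr_LR.
rewrite BE; apply: continuous_big => [|i _]; first exact: add_continuous.
apply: continuous_big => [|j _ p]; first exact: add_continuous.
apply: cvgZ.
  apply: (@continuous_comp _ _ _ fst (fun x : 'rV[R]_m => x 0 i)).
    exact: cvg_fst.
  exact: coord_continuous.
apply: cvgZr_tmp.
apply: (@continuous_comp _ _ _ snd (fun x : 'rV[R]_n => x 0 j)).
  exact: cvg_snd.
exact: coord_continuous.
Qed.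

(** * Differentiating the cross product *)

Section Cross.
Variable R : realType.
Implicit Types (a u v w x y z : R34 R) (X Y : R34 R -> R34 R).

Lemma cross_anticomm x y : cross x y = - cross y x.
Proof.
by apply: R34P; rewrite !(Defs.rowE, crossE); gen_R34 x; gen_R34 y => *; ring.
Qed.

Lemma cross_scaleDl (k : R) u v y :
  cross (k *: u + v) y = k *: cross u y + cross v y.
Proof.
by apply: R34P; rewrite !(Defs.rowE, crossE); gen_R34 u; gen_R34 v; gen_R34 y;
  move=> *; ring.
Qed.

Lemma cross_is_bilinear :
  bilinear_for *:%R *:%R (@cross R : R34 R -> R34 R -> R34 R).
Proof.
split=> [y|x] k u v; first exact: cross_scaleDl.
by rewrite cross_anticomm cross_scaleDl opprD -scalerN -!cross_anticomm.
Qed.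

HB.instance Definition _ :=
  bilinear_isBilinear.Build R (R34 R) (R34 R) (R34 R) _ _ (@cross R)
    cross_is_bilinear.

Lemma crossDl x y z : cross (x + y) z = cross x z + cross y z.
Proof. exact: (linearDl (@cross R)). Qed.

Lemma crossDr x y z : cross x (y + z) = cross x y + cross x z.
Proof. exact: (linearDr (@cross R)). Qed.

Lemma crossNl x y : cross (- x) y = - cross x y.
Proof. exact: (linearNl (@cross R)). Qed.

Lemma crossNr x y : cross x (- y) = - cross x y.
Proof. exact: (linearNr (@cross R)). Qed.

Lemma cross_continuous : continuous (fun p => @cross R p.1 p.2).
Proof. exact: (bilinear_rV_continuous (B := @cross R)). Qed.

Lemma derive_cross X Y x v : differentiable X x -> differentiable Y x ->
  'D_v (fun y => cross (X y) (Y y)) x =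
  cross ('D_v X x) (Y x) + cross (X x) ('D_v Y x).
Proof. exact: (derive_bilin (B := @cross R) cross_continuous). Qed.

Lemma differentiable_cross X Y x : differentiable X x -> differentiable Y x ->
  differentiable (fun y => cross (X y) (Y y)) x.
Proof.
by move=> dX dY; have := is_diff_bilin (B := @cross R) cross_continuous dX dY.
Qed.

Lemma smooth_cross X Y : smooth_on setT X -> smooth_on setT Y ->
  smooth_on setT (fun y => cross (X y) (Y y)).
Proof.
move=> sX sY k.
exact: (Ck_bilin (B := @cross R)) cross_continuous (sX k) (sY k).
Qed.

(** The algebra behind [nijenhuis_cayley]: u and w stand for X x and Y x, while
p, q, r, s stand for the derivatives D_JX Y, D_JY X, D_X Y, D_Y X; those along
JX and JY cancel, and the others only occur through r - s = [X, Y]. *)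
Lemma nijenhuis_cancel x u w (p q r s : R34 R) :
  cross (cross x u) w + cross x p - (cross (cross x w) u + cross x q)
  - (r - s) - cross x (p - (cross w u + cross x s))
  - cross x (cross u w + cross x r - q) =
  cross (cross x u) w + cross u (cross x w) - cross x (cross u w) *+ 2
  - (r - s + cross x (cross x (r - s))).
Proof.
rewrite (cross_anticomm w u) (cross_anticomm (cross x w) u).
rewrite !(crossDr, crossNr) mulr2n.
move: (cross x (cross x r)) (cross x (cross x s)) (cross x (cross u w)).
move: (cross (cross x u) w) (cross u (cross x w)).
move: (cross x p) (cross x q) => *.
by apply/rowP => i; rewrite !Defs.rowE; ring.
Qed.

(** For x in S^{2,4} and X, Y tangent along S^{2,4}, the bracket is tangent and
the last term vanishes by [cayley_almost_complex]. *)
Lemma nijenhuis_cayley X Y x :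
  differentiable X x -> differentiable Y x ->
  let J := cayley_structure x in
  nijenhuis (@cayley_structure R) X Y x =
  (cross (J (X x)) (Y x) + cross (X x) (J (Y x)) - J (cross (X x) (Y x)) *+ 2
   - (lie_bracket X Y x + J (J (lie_bracket X Y x)))) *+ 2.
Proof.
move=> dX dY /=.
rewrite /nijenhuis /apply_field /cayley_structure /normal_vector /lie_bracket.
rewrite !derive_cross ?derive_id //; congr (_ *+ 2).
exact: nijenhuis_cancel.
Qed.

(** * Global tangent fields *)

(** The linear map x |-> x × a is skew for g, so its flow consists of
isometries that preserve every pseudosphere. *)
Definition killing_field a x := cross x a.

(** On S^{3,3} this is (Id + P)(x × a), written as P (a + x × a) so that it is
visibly tangent. *)
Definition eigen_plus_field a x := cross x (a + cross x a).

Lemma killing_local_field (c : R) a :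
  local_field (pseudosphere c) setT (killing_field a).
Proof.
split=> [|x _ _]; last exact: cayley_tangent.
apply: smooth_cross => k; [exact: Ck_id|exact: Ck_cst].
Qed.

Lemma derive_killing a x v : 'D_v (killing_field a) x = cross v a.
Proof.
by rewrite /killing_field derive_cross ?derive_id ?derive_cst // linear0r addr0.
Qed.

Lemma eigen_plus_section a :
  section_of (S33 R) setT (eigen_plus (@cayley_structure R))
    (eigen_plus_field a).
Proof.
split; first split=> [|x _ _]; last 2 first.
- exact: cayley_tangent.
- move=> x xS _; split; first exact: cayley_tangent.
  have PZ : cayley_structure x (eigen_plus_field a x) = eigen_plus_field a x.
    rewrite /eigen_plus_field /cayley_structure /normal_vector !crossDr addrC.
    congr (_ + _); apply: cayley_almost_paracomplex xS _.
    exact: cayley_tangent.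
  by rewrite PZ subrr.
apply: smooth_cross => k; first exact: Ck_id.
apply: CkD; first exact: Ck_cst.
by apply: smooth_cross => ?; [exact: Ck_id|exact: Ck_cst].
Qed.

Lemma derive_eigen_plus a x v :
  'D_v (eigen_plus_field a) x = cross v (a + cross x a) + cross x (cross v a).
Proof.
have dK : differentiable (killing_field a) x.
  exact: differentiable_cross.
have dS : differentiable (cst a + killing_field a) x.
  by apply: differentiableD.
have DS : 'D_v (cst a + killing_field a) x = cross v a.
  rewrite deriveD ?derive_cst ?add0r ?derive_killing //.
  exact: diff_derivable.
rewrite [LHS](derive_cross v (X := idfun) (Y := cst a + killing_field a)) //.
by rewrite derive_id DS.
Qed.

(** * Evaluation at a point *)

(** Indices start at 1, as for the standard units e_1, ..., e_7. *)
Definition e k : R34 R := \row_(j < 7) (j.+1 == k :> nat)%:R.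

Lemma basisE k :
  (e k 0 0 = (1 == k)%:R) * (e k 0 1 = (2 == k)%:R) *
  (e k 0 2 = (3 == k)%:R) * (e k 0 3 = (4 == k)%:R) *
  (e k 0 4 = (5 == k)%:R) * (e k 0 5 = (6 == k)%:R) *
  (e k 0 6 = (7 == k)%:R).
Proof. by rewrite !mxE. Qed.

Lemma cross_table :
  (cross (e 1) (e 2) = e 3) * (cross (e 1) (e 3) = - e 2) *
  (cross (e 1) (e 4) = e 5) * (cross (e 1) (e 5) = - e 4) *
  (cross (e 1) (e 6) = - e 7) * (cross (e 1) (e 7) = e 6) *
  (cross (e 2) (e 1) = - e 3) * (cross (e 2) (e 5) = e 7) *
  (cross (e 3) (e 4) = e 7) * (cross (e 3) (e 5) = - e 6) *
  (cross (e 4) (e 1) = - e 5) * (cross (e 4) (e 2) = - e 6) *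
  (cross (e 4) (e 3) = - e 7) * (cross (e 4) (e 5) = - e 1) *
  (cross (e 4) (e 6) = - e 2) * (cross (e 4) (e 7) = - e 3) *
  (cross (e 5) (e 2) = - e 7) * (cross (e 5) (e 6) = e 3) *
  (cross (e 6) (e 1) = e 7) * (cross (e 6) (e 5) = - e 3).
Proof.
do ![split]; apply: R34P; rewrite !(Defs.rowE, crossE, basisE) /=; ring.
Qed.

(** The bracket of the two fields at e_1 is 2 e_7, on which J J = - Id, so only
the three cross products of the general formula contribute. *)
Lemma nijenhuis_killing :
  nijenhuis (@cayley_structure R) (killing_field (e 2)) (killing_field (e 4))
    (e 1) = - (8%:R *: e 7).
Proof.
rewrite nijenhuis_cayley; [|exact: differentiable_cross..].
rewrite /lie_bracket !derive_killing /killing_field.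
rewrite /cayley_structure /normal_vector.
rewrite !(cross_table, crossDr, crossNl, crossNr) !mulr2n.
move: (e 7) => e7; apply/rowP => i; rewrite !Defs.rowE; ring.
Qed.

(** As e_4 × (e_3 + e_7) = - (e_3 + e_7), the value is a vector of T^-. *)
Lemma lie_bracket_eigen_plus :
  lie_bracket (eigen_plus_field (e 1)) (eigen_plus_field (e 2)) (e 4) =
  2%:R *: (e 3 + e 7).
Proof.
rewrite /lie_bracket !derive_eigen_plus /eigen_plus_field.
rewrite !(cross_table, crossDl, crossDr, crossNl, crossNr).
move: (e 3) (e 7) => e3 e7; apply/rowP => i; rewrite !Defs.rowE; ring.
Qed.

End Cross.

Theorem mainTheorem6 (R : realType) :
  ~ integrable_almost_complex (S24 R) (@cayley_structure R) /\
  ~ integrable_almost_paracomplex (S33 R) (@cayley_structure R).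
Proof.
split.
  move=> J_int.
  have e1S : S24 R (e R 1).
    by rewrite /S24 /pseudosphere /= g34E !basisE /=; ring.
  have := J_int setT _ _ openT (killing_local_field 1 (e R 2))
    (killing_local_field 1 (e R 4)) (e R 1) e1S I.
  rewrite nijenhuis_killing => /(congr1 (fun v : R34 R => v 0 6)).
  rewrite !Defs.rowE basisE mulr1 => /eqP.
  by rewrite oppr_eq0 pnatr_eq0.
move=> [P_int _].
have e4S : S33 R (e R 4).
  by rewrite /S33 /pseudosphere /= g34E !basisE /=; ring.
have [_] := P_int setT _ _ openT (eigen_plus_section (e R 1))
  (eigen_plus_section (e R 2)) (e R 4) e4S I.
rewrite lie_bracket_eigen_plus /cayley_structure /normal_vector.
rewrite scaler_nat mulr2n.
rewrite !crossDr !cross_table => /(congr1 (fun v : R34 R => v 0 2)).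
rewrite !Defs.rowE !basisE /= => /eqP.
rewrite (_ : _ - _ = 4%:R); last by ring.
by rewrite pnatr_eq0.
Qed.
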